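(* Let $P$ be an online minimization problem. If $A$ is a $c_A$-competitive deterministic online algorithm for $P$ with $b_A$ advice bits, then there is a $c_A$-competitive quantum online algorithm with shared qubits for $P$ using $\lceil b_A/2\rceil$ advice qubits. If $R$ is a $c_B$-competitive (in expectation) randomized online algorithm for $P$ with $b_B$ advice bits, then there is a $c_B$-competitive quantum online algorithm with shared qubits for $P$ using $\lceil b_B/2\rceil$ advice qubits.
   Context: An online minimization problem has inputs $I=(x_1,\dots,x_n)$, outputs $(y_1,\dots,y_n)$ and a positive cost; $Opt$ is an optimal offline algorithm. An online algorithm with advice computes $y_i$ from an advice message sent by an Adviser who knows the whole input and from $x_1,\dots,x_i$ (and, if randomized, from uniformly random bits); it is $c$-competitive with advice complexity $b$ if there is $\alpha\ge0$ such that for every $n$ and every input of length at most $n$ there is an advice message of length at most $b$ with (expected) cost $\le c\cdot cost(Opt(I))+\alpha$. A quantum online algorithm with advice receives a quantum advice message of at most $b$ qubits, may have classical and quantum parts and measure at any time, competitiveness in expectation. It has shared qubits if, before the computation, the algorithm prepares qubits (possibly entangled) and sends part of them to the Adviser; these shared qubits are not counted as advice qubits.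
   Formalization: Advice messages have exactly b bits rather than length at most b, since a visible length would carry extra information and make the claim false (for b=2, seven bit messages exceed what one advice qubit with shared qubits can convey). *)

(* Defs.v *)
From mathcomp Require Import all_boot all_order all_algebra.
From mathcomp Require Import sesquilinear spectral.
From mathcomp Require Import reals.
From mathcomp Require Import complex mxtens.

Set Implicit Arguments.
Unset Strict Implicit.
Unset Printing Implicit Defensive.

Import Order.TTheory GRing.Theory Num.Theory.

Local Open Scope ring_scope.
Local Open Scope complex_scope.
Local Open Scope sesquilinear_scope.

(** * Online minimization problems *)

Record online_problem (R : realType) (X Y : Type) := OnlineProblem {
  is_input : seq X -> Prop;
  feasible : seq X -> pred (seq Y);
  cost : seq X -> seq Y -> R;
  opt : seq X -> seq Y;
  feasible_size : forall I O, is_input I -> feasible I O -> size O = size I;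
  cost_gt0 : forall I O, is_input I -> feasible I O -> 0 < cost I O;
  opt_feasible : forall I, is_input I -> feasible I (opt I);
  opt_min : forall I O, is_input I -> feasible I O -> cost I (opt I) <= cost I O
}.

(** * Advice

    The advice complexity is a function [b : nat -> nat] of the bound [n] on the
    length of the input; a complexity not depending on [n] is a constant [b].
    An algorithm is told about [n] only what the length of its message reveals.
    A message of length at most [b n] is delivered padded to exactly [b n]
    symbols (bits or qubits), so that its length carries no other information.  Were the length of a classical message
    informative, [2 ^ b.+1 - 1] messages could be distinguished, and for even
    [b >= 2] that is more than at most [b./2] qubits can convey, even with
    shared qubits. *)

(** * Deterministic algorithms *)

(** [A phi xs] is the answer to the last request of [xs], the requests so far. *)
Definition det_algorithm (X Y : Type) := seq bool -> seq X -> Y.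

Definition det_output (X Y : Type) (A : det_algorithm X Y)
    (phi : seq bool) (I : seq X) : seq Y :=
  mkseq (fun i => A phi (take i.+1 I)) (size I).

Definition det_competitive (R : realType) (X Y : Type)
    (P : online_problem R X Y) (A : det_algorithm X Y)
    (c : R) (b : nat -> nat) : Prop :=
  exists2 alpha : R, 0 <= alpha &
    forall (n : nat) (I : seq X), is_input P I -> (size I <= n)%N ->
    exists phi : (b n).-tuple bool,
      feasible P I (det_output A phi I) /\
      cost P I (det_output A phi I) <= c * cost P I (opt P I) + alpha.

(** * Competitiveness in expectation

    [E] sends a function of the output to its expectation. *)
Definition competitive_on (R : realType) (X Y : Type)
    (P : online_problem R X Y) (c alpha : R) (I : seq X)
    (E : (seq Y -> R) -> R) : Prop :=
  E (fun O => (feasible P I O)%:R) = 1 /\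
  E (cost P I) <= c * cost P I (opt P I) + alpha.

(** * Randomized algorithms

    The answer to the last request of [xs] is computed from the first
    [rand_reads phi xs] bits of a tape of independent uniformly random bits.
    Reading the tape adaptively is no more general: an algorithm that answers on
    every tape reads boundedly many bits for given [phi] and [xs] (by Koenig's
    lemma), and it may ignore some of the bits it is given. *)
Record rand_algorithm (X Y : Type) := RandAlgorithm {
  rand_reads : seq bool -> seq X -> nat;
  rand_answer : seq bool -> seq bool -> seq X -> Y
}.

Definition rand_bits (X Y : Type) (A : rand_algorithm X Y)
    (phi : seq bool) (I : seq X) : nat :=
  \max_(i < size I) rand_reads A phi (take i.+1 I).

Definition rand_output (X Y : Type) (A : rand_algorithm X Y)
    (phi psi : seq bool) (I : seq X) : seq Y :=
  mkseq (fun i => let xs := take i.+1 I in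
    rand_answer A phi (take (rand_reads A phi xs) psi) xs) (size I).

Definition rand_expect (R : realType) (X Y : Type) (A : rand_algorithm X Y)
    (phi : seq bool) (I : seq X) (F : seq Y -> R) : R :=
  (\sum_(psi : (rand_bits A phi I).-tuple bool) F (rand_output A phi psi I))
    / 2 ^+ rand_bits A phi I.

Definition rand_competitive (R : realType) (X Y : Type)
    (P : online_problem R X Y) (A : rand_algorithm X Y)
    (c : R) (b : nat -> nat) : Prop :=
  exists2 alpha : R, 0 <= alpha &
    forall (n : nat) (I : seq X), is_input P I -> (size I <= n)%N ->
    exists phi : (b n).-tuple bool,
      competitive_on P c alpha I (rand_expect A phi I).

(** * Quantum algorithms with shared qubits *)

Definition kraus_complete (R : realType) (r m n : nat)
    (K : 'I_r -> 'M[R[i]]_(m, n)) : Prop :=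
  \sum_(j < r) (K j)^t* *m K j = 1%:M.

(** What the algorithm does when its advice consists of [q] qubits.

    Before the computation it prepares [work 0 + shared] qubits in the pure state
    [init] and sends the last [shared] of them to the Adviser, who sends back the
    [q] qubits of the message.  After [k] requests the algorithm holds [work k]
    qubits of its own and the [q] qubits in which the message arrived.

    Its classical part remembers the requests [xs] so far and the list [h] of
    measurement outcomes so far, latest first, one per request.  At a request it
    applies the quantum instrument with [noutcomes xs h] outcomes and Kraus
    operators [kraus xs h o]; here [xs] includes the new request while [h] does
    not include the new outcome.  Unitary evolution, fresh ancillas, discarding
    of qubits, coin tosses and any finite number of intermediate measurements
    are all of this form; an instrument with several Kraus operators per outcome
    is obtained by ignoring part of [o].  The answer is [qanswer xs h], where [h]
    includes the outcome for the last request of [xs]. *)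
Record quantum_algorithm (R : realType) (X Y : Type) (q : nat) :=
  QuantumAlgorithm {
  shared : nat;
  work : nat -> nat;
  init : 'cV[R[i]]_(2 ^ work 0 * 2 ^ shared);
  noutcomes : seq X -> seq nat -> nat;
  kraus : forall (xs : seq X) (h : seq nat), nat ->
    'M[R[i]]_(2 ^ work (size h).+1 * 2 ^ q, 2 ^ work (size h) * 2 ^ q);
  qanswer : seq X -> seq nat -> Y;
  init_unit : init^t* *m init = 1%:M;
  krausP : forall xs h,
    kraus_complete (fun o : 'I_(noutcomes xs h) => kraus xs h o)
}.

(** The density matrix held by the algorithm once the Adviser has applied to the
    shared qubits the channel with Kraus operators [M] and sent the result. *)
Definition advised_state (R : realType) (X Y : Type) (q : nat)
    (Q : quantum_algorithm R X Y q) (r : nat)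
    (M : 'I_r -> 'M[R[i]]_(2 ^ q, 2 ^ shared Q)) :
    'M[R[i]]_(2 ^ work Q 0 * 2 ^ q) :=
  \sum_(j < r) let v := (1%:M *t M j) *m init Q in v *m v^t*.

(** Expectation of [F] at the output, for the requests [rest] still to come.
    [rho] is the unnormalized state, whose trace is the probability of [h];
    [ys] are the answers already given to [xs]. *)
Fixpoint quantum_expect_from (R : realType) (X Y : Type) (q : nat)
    (Q : quantum_algorithm R X Y q) (F : seq Y -> R)
    (rest xs : seq X) (h : seq nat) (ys : seq Y)
    (rho : 'M[R[i]]_(2 ^ work Q (size h) * 2 ^ q)) {struct rest} : R :=
  if rest is x :: rest' then
    let xs' := rcons xs x in
    \sum_(o < noutcomes Q xs' h)
      @quantum_expect_from R X Y q Q F rest' xs' (nat_of_ord o :: h)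
        (rcons ys (qanswer Q xs' (nat_of_ord o :: h)))
        (kraus Q xs' h o *m rho *m (kraus Q xs' h o)^t*)
  else complex.Re (\tr rho) * F ys.

Definition quantum_expect (R : realType) (X Y : Type) (q : nat)
    (Q : quantum_algorithm R X Y q)
    (rho : 'M[R[i]]_(2 ^ work Q 0 * 2 ^ q)) (I : seq X)
    (F : seq Y -> R) : R :=
  @quantum_expect_from R X Y q Q F I [::] [::] [::] rho.

(** The Adviser, knowing [I], chooses the channel [M]. *)
Definition quantum_competitive (R : realType) (X Y : Type)
    (P : online_problem R X Y) (Q : forall q, quantum_algorithm R X Y q)
    (c : R) (b : nat -> nat) : Prop :=
  exists2 alpha : R, 0 <= alpha &
    forall (n : nat) (I : seq X), is_input P I -> (size I <= n)%N ->
    exists (r : nat) (M : 'I_r -> 'M[R[i]]_(2 ^ b n, 2 ^ shared (Q (b n)))),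
      kraus_complete M /\
      competitive_on P c alpha I
        (quantum_expect (advised_state M) I).

(* Main.v *)
Require Import Defs.
From mathcomp Require Import all_boot all_order all_algebra reals.
From mathcomp Require Import sesquilinear spectral complex mxtens boolp.

(* Superdense coding.  The algorithm and the Adviser share [q] Bell pairs; the
   Adviser encodes one of [4 ^ q] messages by applying to its half one of
   [4 ^ q] pairwise orthogonal unitaries and returns that half, which puts the
   algorithm in one of [4 ^ q] orthonormal states.  The algorithm measures in
   this basis: the outcome is the message and the state is left unchanged, so
   it may repeat the measurement at every request, together with the coin
   tosses it needs.

   A message of [q] qubits may stand for [2q] or for [2q - 1] bits.  As inputs
   of length at most [n] are also inputs of length at most [n'] for [n <= n'],
   one of the two lengths serves all [n], namely one that is taken beyond every
   [n] for which the message has [q] qubits. *)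

Import Order.TTheory GRing.Theory Num.Theory.
Local Open Scope ring_scope.
Local Open Scope complex_scope.
Local Open Scope sesquilinear_scope.

(** * Hadamard matrices and an orthogonal basis of unitaries *)

(** These are the tensor powers of the 2 by 2 matrix with rows (1, 1) and (1, -1). *)
Lemma exists_sylvester_hadamard (R : comNzRingType) (q : nat) :
  exists2 H : 'M[R]_(2 ^ q), forall i j, H i j * H i j = 1 &
    H *m H^T = (2 ^ q)%:R%:M.
Proof.
elim: q => [|q [H H1 HH]].
  exists 1%:M; last by rewrite trmx1 mulmx1.
  by move=> i j; rewrite !ord1 !mxE eqxx mulr1.
rewrite expnS; pose S : 'M[R]_2 := \matrix_(i, j) (-1) ^+ (i * j).
have S1 i j : S i j * S i j = 1 by rewrite mxE -signr_odd -expr2 sqrr_sign.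
have SS : S *m S^T = 2%:R%:M.
  apply/matrixP => i j; rewrite !mxE !big_ord_recl big_ord0 !mxE.
  case: i j => [[|[|//]] ?] [[|[|//]] ?] /=;
    rewrite ?(mul0n, muln0, muln1) ?mulrNN ?mulr1 ?mul1r ?addr0 ?mulr1n;
    by rewrite ?mulr0n ?subrr.
exists (S *t H).
  move=> i j; case: (mxtens_indexP i) => i1 i2.
  case: (mxtens_indexP j) => j1 j2.
  by rewrite tensmxE mulrACA S1 H1 mulr1.
rewrite trmx_tens tensmx_mul SS HH; apply/matrixP => i j.
case: (mxtens_indexP i) => i1 i2; case: (mxtens_indexP j) => j1 j2.
rewrite tensmxE !mxE (inj_eq (can_inj (@mxtens_indexK _ _))) xpair_eqE.
by rewrite -!mulrnA -natrM mulnACA mulnb.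
Qed.

(* The real Weyl operators "shift by [b], then multiply pointwise by row [a] of
   a Hadamard matrix". *)
Lemma exists_orthogonal_unitary_basis (R : comNzRingType) (q : nat) :
  exists2 u : 'I_(2 ^ q * 2 ^ q) -> 'M[R]_(2 ^ q),
    forall a, (u a)^T *m u a = 1%:M &
    forall a b, \sum_i \sum_j u a i j * u b i j = (2 ^ q)%:R * (a == b)%:R.
Proof.
have [H H1 HH] := exists_sylvester_hadamard R q.
(* Once the dimension is a successor, ['I_d.+1] is a cyclic group, and its addition is the shift. *)
move: (expn_gt0 2 q) H H1 HH; case: (2 ^ q)%N => // d _ H H1 HH.
pose u (a : 'I_(d.+1 * d.+1)) : 'M[R]_d.+1 := \matrix_(i, j)
  (H (mxtens_unindex a).1 i * (j == i + (mxtens_unindex a).2)%:R).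
have uE a b i j : u (mxtens_index (a, b)) i j = H a i * (j == i + b)%:R.
  by rewrite mxE mxtens_indexK.
exists u.
  move=> a; set s := (mxtens_unindex a).2; apply/matrixP => j k; rewrite !mxE.
  rewrite (bigD1 (j - s)) //= big1 => [|i ij]; last first.
    by rewrite !mxE -subr_eq [_ == i]eq_sym (negPf ij) mulr0 mul0r.
  by rewrite !mxE subrK eqxx mulr1 mulrA H1 mul1r addr0 eq_sym.
move=> a b; case: (mxtens_indexP a) => a1 a2; case: (mxtens_indexP b) => b1 b2.
rewrite (inj_eq (can_inj (@mxtens_indexK _ _))) xpair_eqE.
have -> : d.+1%:R * ((a1 == b1) && (a2 == b2))%:R =
    (H *m H^T) a1 b1 * (a2 == b2)%:R.
  by rewrite HH !mxE; case: (a1 == b1); rewrite ?mulr1n ?mulr0n ?mulr0 ?mul0r.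
rewrite mxE mulr_suml; apply: eq_bigr => i _.
(* Row [i] of the first operator is supported in column [i + a2], where the second one is nonzero
   just when [a2 = b2]. *)
rewrite (bigD1 (i + a2)) //= big1 => [|j /negPf ij]; last first.
  by rewrite !uE ij mulr0 mul0r.
by rewrite !uE mxE eqxx mulr1 (inj_eq (addrI i)) addr0 mulrA.
Qed.

(** * Vectorization and the Bell basis *)

(** The sum over [i] of the tensors of [e_i] with [A e_i]: the operator [A] applied to the second
    half, the Adviser's, of unnormalized Bell pairs. *)
Definition vec {R : comNzRingType} {d : nat} (A : 'M[R]_d) : 'cV[R]_(d * d) :=
  \col_k A (mxtens_unindex k).2 (mxtens_unindex k).1.

Lemma sum_mxtens_index (V : nmodType) (m n : nat) (f : 'I_(m * n) -> V) :
  \sum_k f k = \sum_i \sum_j f (mxtens_index (i, j)).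
Proof.
rewrite pair_big (reindex (@mxtens_index m n)) /=.
  by apply: eq_bigr => -[].
by exists (@mxtens_unindex m n) => k _;
  rewrite (mxtens_indexK, mxtens_unindexK).
Qed.

Lemma mxtens_index_div (m n : nat) (i : 'I_m) (j : 'I_n) :
  (mxtens_index (i, j) %/ n)%N = i.
Proof. by have /(congr1 (fun p => val p.1)) := mxtens_indexK (i, j). Qed.

Lemma mxtens_index_mod (m n : nat) (i : 'I_m) (j : 'I_n) :
  (mxtens_index (i, j) %% n)%N = j.
Proof. by have /(congr1 (fun p => val p.2)) := mxtens_indexK (i, j). Qed.

Lemma vecE (R : comNzRingType) (d : nat) (A : 'M[R]_d) i j :
  vec A (mxtens_index (i, j)) 0 = A j i.
Proof. by rewrite mxE mxtens_indexK. Qed.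

Lemma tensmx_vec (R : comNzRingType) (d : nat) (A B : 'M[R]_d) :
  (1%:M *t A) *m vec B = vec (A *m B).
Proof.
apply/matrixP => k l; rewrite [l]ord1; case: (mxtens_indexP k) => i j.
rewrite vecE !mxE sum_mxtens_index (bigD1 i) //= [X in _ + X]big1 ?addr0.
  by apply: eq_bigr => m _; rewrite tensmxE vecE mxE eqxx mul1r.
move=> i' /negPf ii'; apply: big1 => m _.
by rewrite tensmxE mxE eq_sym ii' !mul0r.
Qed.

Lemma vec_dot (R : comNzRingType) (d : nat) (A B : 'M[R]_d) :
  (vec A)^T *m vec B = (\sum_i \sum_j A i j * B i j)%:M.
Proof.
apply/matrixP => k l; rewrite [k]ord1 [l]ord1 !mxE eqxx mulr1n.
rewrite sum_mxtens_index exchange_big /=.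
by apply: eq_bigr => i _; apply: eq_bigr => j _; rewrite [_^T _ _]mxE !vecE.
Qed.

(** There are as many vectors as dimensions, so they are the columns of a square matrix, whose left
    inverse is also a right inverse. *)
Lemma sum_orthonormal (R : comNzRingType) (n : nat) (v : 'I_n -> 'cV[R]_n) :
  (forall a b, (v a)^T *m v b = (a == b)%:R%:M) ->
  \sum_a v a *m (v a)^T = 1%:M.
Proof.
move=> ortho; pose V : 'M_n := \matrix_(i, a) v a i 0.
have /mulmx1C VV : V^T *m V = 1%:M.
  apply/matrixP => a b; have /matrixP/(_ 0 0) := ortho a b.
  rewrite !mxE eqxx mulr1n => <-; apply: eq_bigr => i _.
  by rewrite !mxE.
rewrite -[RHS]VV; apply/matrixP => i j; rewrite summxE !mxE.
by apply: eq_bigr => a _; rewrite !mxE big_ord1 !mxE.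
Qed.

(** Vectorization turns the entrywise inner product of matrices into that of vectors, so the
    orthogonal unitaries yield orthonormal states; the identity yields [v0], the [q] Bell pairs. All
    entries are real, so transposes serve as adjoints. *)
Lemma exists_bell_basis (R : realType) (q : nat) :
  exists (v0 : 'cV[R]_(2 ^ q * 2 ^ q))
    (v : 'I_(2 ^ q * 2 ^ q) -> 'cV[R]_(2 ^ q * 2 ^ q)),
  [/\ v0^T *m v0 = 1%:M,
      forall a b, (v a)^T *m v b = (a == b)%:R%:M &
      forall a, exists2 u : 'M[R]_(2 ^ q), u^T *m u = 1%:M &
        (1%:M *t u) *m v0 = v a].
Proof.
have [u u1 uu] := exists_orthogonal_unitary_basis R q.
set d := (2 ^ q)%N in u u1 uu *.
have d0 : d%:R != 0 :> R by rewrite pnatr_eq0 -lt0n expn_gt0.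
pose s : R := (Num.sqrt d%:R)^-1.
have ss : s * s * d%:R = 1.
  by rewrite -invfM -expr2 sqr_sqrtr ?ler0n // mulVf.
have sdot A B : (s *: vec A)^T *m (s *: vec B) =
    (s * s * \sum_i \sum_j A i j * B i j)%:M.
  rewrite -scalemxAr [(s *: _)^T]linearZ /= -scalemxAl scalerA vec_dot.
  by rewrite scale_scalar_mx.
exists (s *: vec 1%:M), (fun a => s *: vec (u a)); split.
- rewrite sdot (eq_bigr (fun=> 1)) ?sumr_const ?card_ord ?ss // => i _.
  rewrite (bigD1 i) //= big1 ?mxE ?eqxx ?mulr1 ?addr0 // => j /negPf ij.
  by rewrite !mxE eq_sym ij mulr0.
- by move=> a b; rewrite sdot uu mulrA ss mul1r.
- by move=> a; exists (u a); rewrite ?u1 // -scalemxAr tensmx_vec mulmx1.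
Qed.

(** * Bit strings coded by numbers, and averages over coin tosses *)

Definition bitstring (n o : nat) : seq bool :=
  nth [::] (map val (enum {: n.-tuple bool})) o.

Lemma size_enum_bits n : size (enum {: n.-tuple bool}) = (2 ^ n)%N.
Proof. by rewrite -cardT card_tuple card_bool. Qed.

Lemma sum_bitstring (V : nmodType) (n : nat) (G : seq bool -> V) :
  \sum_(o < 2 ^ n) G (bitstring n o) = \sum_(s : n.-tuple bool) G s.
Proof.
rewrite -[RHS]big_enum -(big_map val xpredT G) (big_nth [::]) big_mkord.
by rewrite size_map size_enum_bits.
Qed.

Lemma size_bitstring (n o : nat) : (o < 2 ^ n)%N -> size (bitstring n o) = n.
Proof.
rewrite -size_enum_bits => lto.
by rewrite /bitstring (nth_map (nseq_tuple n false) _ _ lto) size_tuple.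
Qed.

Lemma bitstring_surj (n : nat) (s : n.-tuple bool) :
  exists2 o, (o < 2 ^ n)%N & bitstring n o = s.
Proof.
exists (index s (enum {: n.-tuple bool})).
  by rewrite -size_enum_bits index_mem mem_enum.
by rewrite /bitstring (nth_map s) ?nth_index ?index_mem ?mem_enum.
Qed.

Definition coin_mean {R : fieldType} (n : nat) (G : seq bool -> R) : R :=
  (\sum_(s : n.-tuple bool) G s) / 2 ^+ n.

Lemma eq_coin_mean (R : fieldType) (n : nat) (G1 G2 : seq bool -> R) :
  (forall s, size s = n -> G1 s = G2 s) -> coin_mean n G1 = coin_mean n G2.
Proof.
by move=> G12; congr (_ / _); apply: eq_bigr => s _; rewrite G12 ?size_tuple.
Qed.

Lemma coin_mean0 (R : fieldType) (G : seq bool -> R) : coin_mean 0 G = G [::].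
Proof.
rewrite /coin_mean divr1 (big_pred1 [tuple]) // => s.
by symmetry; apply/eqP; exact: tuple0.
Qed.

Lemma coin_meanS (R : fieldType) (n : nat) (G : seq bool -> R) :
  coin_mean n.+1 G =
    (coin_mean n (fun s => G (true :: s)) +
     coin_mean n (fun s => G (false :: s))) / 2.
Proof.
rewrite /coin_mean -mulrDl exprS invfM mulrA mulrAC; congr (_ / _ / _).
rewrite (reindex (fun p : bool * n.-tuple bool => [tuple of p.1 :: p.2])) /=.
  by rewrite -(pair_big xpredT xpredT (fun b s => G (b :: tval s))) big_bool.
exists (fun s => (thead s, [tuple of behead s])) => [[b s] _|s _] /=.
  by rewrite theadE; congr (_, _); apply: val_inj.
by rewrite [RHS]tuple_eta.
Qed.

Lemma coin_meanD (R : fieldType) (m n : nat) (G : seq bool -> R) :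
  coin_mean (m + n) G =
  coin_mean m (fun s => coin_mean n (fun t => G (s ++ t))).
Proof.
elim: m G => [|m IH] G; first by rewrite coin_mean0.
by rewrite addSn !coin_meanS !IH.
Qed.

Lemma coin_mean_const (R : numFieldType) (n : nat) (c : R) :
  coin_mean n (fun=> c) = c.
Proof.
rewrite /coin_mean sumr_const card_tuple card_bool -[c *+ _]mulr_natr natrX.
by rewrite mulfK // expf_neq0 // pnatr_eq0.
Qed.

Lemma coin_meanE (R : fieldType) (n : nat) (G : seq bool -> R) :
  coin_mean n G = \sum_(o < 2 ^ n) 2 ^- n * G (bitstring n o).
Proof. by rewrite -mulr_sumr sum_bitstring mulrC. Qed.

(** * Real Kraus operators and the superdense coding algorithm *)

Notation complexify := (map_mx (real_complex _)).

Lemma adjoint_complexify (R : rcfType) (m n : nat) (A : 'M[R]_(m, n)) :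
  (complexify A)^t* = complexify A^T.
Proof.
by apply/matrixP => i j; rewrite !mxE; congr (_ +i* _); rewrite oppr0.
Qed.

Lemma kraus_complete_complexify (R : realType) (r m n : nat)
    (K : 'I_r -> 'M[R]_(m, n)) :
  \sum_j (K j)^T *m K j = 1%:M ->
  kraus_complete (fun j => complexify (K j)).
Proof.
move=> K1; rewrite /kraus_complete -(map_mx1 (real_complex R)) -K1 raddf_sum.
by apply: eq_bigr => j _; rewrite adjoint_complexify /= map_mxM.
Qed.

(* The number of tosses is fixed before the advice is measured, hence cannot
   depend on it. *)
Definition max_reads {X Y : Type} (B : rand_algorithm X Y) (l : nat)
    (xs : seq X) : nat :=
  \max_(phi : l.-tuple bool) rand_reads B phi xs.

(** The remainder of an outcome codes the coins of its request. As [h] lists the latest outcome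
    first, [h'] belongs to the first [size h'] requests, and its coins precede the new ones. *)
Fixpoint tape {X Y : Type} (B : rand_algorithm X Y) (l : nat)
    (xs : seq X) (h : seq nat) : seq bool :=
  if h is o :: h' then
    tape B l (take (size h') xs) h' ++
    bitstring (max_reads B l xs) (o %% 2 ^ max_reads B l xs)
  else [::].

(** The quotient of the latest outcome is the index of the measured basis state, which codes the
    advice. *)
Definition superdense_answer {X Y : Type} (B : rand_algorithm X Y) (l : nat)
    (xs : seq X) (h : seq nat) : Y :=
  let phi := bitstring l (head 0%N h %/ 2 ^ max_reads B l xs) in
  rand_answer B phi (take (rand_reads B phi xs) (tape B l xs h)) xs.

(** Kraus operators are indexed by natural numbers, hence the extension by zero. *)
Definition nat_family {V : nmodType} {n : nat} (P : 'I_n -> V) (a : nat) : V :=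
  oapp P 0 (insub a).

Lemma nat_familyE (V : nmodType) (n : nat) (P : 'I_n -> V) (a : 'I_n) :
  nat_family P a = P a.
Proof. by rewrite /nat_family valK. Qed.

(* Outcome [a * 2 ^ k + c]: the measurement [P] yields [a] and [k] fair coins
   yield [c]. *)
Definition measure_and_toss {R : rcfType} {n : nat} (P : 'I_n -> 'M[R]_n)
    (k o : nat) : 'M[R]_n :=
  Num.sqrt (2 ^- k) *: nat_family P (o %/ 2 ^ k).

Lemma sqrt_coins (R : rcfType) (k : nat) :
  Num.sqrt (2 ^- k) * Num.sqrt (2 ^- k) = 2 ^- k :> R.
Proof. by rewrite -expr2 sqr_sqrtr // invr_ge0 exprn_ge0. Qed.

Lemma measure_and_toss_complete (R : rcfType) (n : nat) (P : 'I_n -> 'M[R]_n)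
    (k : nat) :
  \sum_a (P a)^T *m P a = 1%:M ->
  \sum_(o < n * 2 ^ k)
    (measure_and_toss P k o)^T *m measure_and_toss P k o = 1%:M.
Proof.
move=> P1; rewrite sum_mxtens_index -[RHS]P1; apply: eq_bigr => a _.
rewrite (eq_bigr (fun=> 2 ^- k *: ((P a)^T *m P a))) => [|c _].
  rewrite sumr_const card_ord -scaler_nat scalerA natrX divff ?scale1r //.
  by rewrite expf_neq0 // pnatr_eq0.
rewrite /measure_and_toss mxtens_index_div nat_familyE.
by rewrite -scalemxAr [(_ *: _)^T]linearZ /= -scalemxAl scalerA sqrt_coins.
Qed.

Lemma adjoint_complexify_unit (R : rcfType) (n : nat) (v : 'cV[R]_n) :
  v^T *m v = 1%:M -> (complexify v)^t* *m complexify v = 1%:M.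
Proof. by move=> v1; rewrite adjoint_complexify -map_mxM v1 map_mx1. Qed.

Definition superdense_algorithm {R : realType} {X Y : Type}
    (B : rand_algorithm X Y) (l q : nat) (v0 : 'cV[R]_(2 ^ q * 2 ^ q))
    (P : 'I_(2 ^ q * 2 ^ q) -> 'M[R]_(2 ^ q * 2 ^ q))
    (v0_unit : v0^T *m v0 = 1%:M)
    (P_complete : \sum_a (P a)^T *m P a = 1%:M) : quantum_algorithm R X Y q :=
  @QuantumAlgorithm R X Y q q (fun=> q) (complexify v0)
    (fun xs _ => 2 ^ q * 2 ^ q * 2 ^ max_reads B l xs)%N
    (fun xs _ o => complexify (measure_and_toss P (max_reads B l xs) o))
    (superdense_answer B l)
    (adjoint_complexify_unit _ _ _ v0_unit)
    (fun xs _ => kraus_complete_complexify _ _ _ _ _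
       (measure_and_toss_complete _ _ _ _ P_complete)).

(** * Simulation of a randomized algorithm *)

Lemma quantum_expect_from0 (R : realType) (X Y : Type) (q : nat)
    (Q : quantum_algorithm R X Y q) (F : seq Y -> R) (rest xs : seq X)
    (h : seq nat) (ys : seq Y) :
  @quantum_expect_from R X Y q Q F rest xs h ys 0 = 0.
Proof.
elim: rest xs h ys => [|x rest IH] xs h ys /=; first by rewrite mxtrace0 mul0r.
by apply: big1 => o _; rewrite mulmx0 mul0mx IH.
Qed.

(** Induction on the remaining requests: the state stays a multiple of the projector [P a], and the
    weight [w] is shared equally among the toss strings of each request. The average runs over the
    tosses still to come, appended to those recorded in [h]. *)
Lemma quantum_expect_from_superdense (R : realType) (X Y : Type)
    (B : rand_algorithm X Y) (l q : nat) (v0 : 'cV[R]_(2 ^ q * 2 ^ q))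
    (P : 'I_(2 ^ q * 2 ^ q) -> 'M[R]_(2 ^ q * 2 ^ q)) v0_unit P_complete
    (P_sym : forall a, (P a)^T = P a) (P_tr : forall a, \tr (P a) = 1)
    (P_mul : forall a b, P a *m P b = (a == b)%:R *: P a)
    (Q := superdense_algorithm B l q v0 P v0_unit P_complete)
    (a : 'I_(2 ^ q * 2 ^ q)) (phi : l.-tuple bool)
    (F : seq Y -> R) (rest xs : seq X) (h : seq nat) (ys : seq Y) (w : R) :
  bitstring l a = phi -> size h = size xs ->
  @quantum_expect_from R X Y q Q F rest xs h ys (complexify (w *: P a)) =
  w * coin_mean (\sum_(i < size rest) max_reads B l (xs ++ take i.+1 rest))
    (fun s => F (ys ++ mkseq (fun i => let xs' := xs ++ take i.+1 rest in
       rand_answer B phi (take (rand_reads B phi xs') (tape B l xs h ++ s)) xs')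
       (size rest))).
Proof.
move=> aphi; elim: rest xs h ys w => [|x rest IH] xs h ys w hxs.
  rewrite big_ord0 coin_mean0 /= cats0.
  by rewrite trace_map_mx mxtraceZ P_tr mulr1 /mkseq /= cats0.
set xs' := rcons xs x; set K := max_reads B l xs'.
pose M := measure_and_toss P K.
transitivity (\sum_(o < 2 ^ q * 2 ^ q * 2 ^ K)
    @quantum_expect_from R X Y q Q F rest xs' ((o : nat) :: h)
      (rcons ys (superdense_answer B l xs' ((o : nat) :: h)))
      (complexify (M o *m (w *: P a) *m (M o)^T))).
  apply: eq_bigr => o _; rewrite !map_mxM /=.
  by rewrite -adjoint_complexify.
(* Measuring some [b] other than [a] leaves the zero state, as [P b *m P a = 0]. *)
rewrite sum_mxtens_index (bigD1 a) //= [X in _ + X]big1 ?addr0; last first.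
  move=> b /negPf ba; apply: big1 => c _.
  rewrite /M /measure_and_toss mxtens_index_div nat_familyE.
  rewrite -scalemxAl -scalemxAr P_mul ba scale0r !scaler0 mul0mx map_mx0.
  exact: quantum_expect_from0.
have xsE i : xs ++ take i.+1 (x :: rest) = xs' ++ take i rest.
  by rewrite /= cat_rcons.
rewrite big_ord_recl; under [X in coin_mean (_ + X)]eq_bigr do rewrite xsE.
(* The [K] tosses of the current request are split off; the inner average is left to the induction
   hypothesis. *)
rewrite xsE take0 cats0 -/K coin_meanD coin_meanE mulr_sumr.
apply: eq_bigr => c _; rewrite mulrA.
have -> : M (mxtens_index (a, c)) *m (w *: P a) *m (M (mxtens_index (a, c)))^T =
    (w * 2 ^- K) *: P a.
  rewrite /M /measure_and_toss mxtens_index_div nat_familyE.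
  rewrite [(_ *: _)^T]linearZ /= P_sym.
  rewrite -!(scalemxAl, scalemxAr) !P_mul eqxx !scale1r P_mul eqxx scale1r.
  by rewrite !scalerA sqrt_coins mulrC.
rewrite IH; last by rewrite /xs' size_rcons /= hxs.
congr (_ * _); apply: eq_coin_mean => s _; rewrite cat_rcons.
have tape_cons : tape B l xs' ((mxtens_index (a, c) : nat) :: h) =
    tape B l xs h ++ bitstring K c.
  rewrite [LHS]/= /xs' hxs -cats1 take_size_cat // cats1 -/xs' -/K.
  by rewrite [X in bitstring _ X]mxtens_index_mod.
rewrite tape_cons /superdense_answer tape_cons -/K.
congr (F (ys ++ _)); rewrite [in RHS]/mkseq /= (iotaDl 1 0) -map_comp.
congr (_ :: _); last by apply: eq_map => i /=; rewrite cat_rcons catA.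
rewrite [X in bitstring _ X]mxtens_index_div aphi take0 cats1 -/xs'.
(* The answer to the current request does not look into the later tosses [s], since its [K] fresh
   ones already cover what it reads under [phi]. *)
rewrite catA [in RHS]takel_cat //.
rewrite size_cat size_bitstring // (leq_trans _ (leq_addl _ _)) //.
exact: (leq_bigmax phi).
Qed.

(** Bits beyond those read by any answer average out. *)
Lemma rand_expect_coin_mean (R : realType) (X Y : Type)
    (B : rand_algorithm X Y) (phi : seq bool) (I : seq X)
    (F : seq Y -> R) (N : nat) :
  (rand_bits B phi I <= N)%N ->
  rand_expect B phi I F = coin_mean N (fun s => F (rand_output B phi s I)).
Proof.
move=> /subnKC <-; rewrite coin_meanD.
transitivity (coin_mean (rand_bits B phi I)
  (fun s => F (rand_output B phi s I))); first by [].
apply: eq_coin_mean => s sizes.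
rewrite -[LHS](coin_mean_const _ (N - rand_bits B phi I)).
apply: eq_coin_mean => t _; congr F; apply/eq_in_map => i.
rewrite mem_iota => /= iI; rewrite takel_cat // sizes.
exact: (leq_bigmax (Ordinal iI)).
Qed.

Lemma superdense_simulation (R : realType) (X Y : Type)
    (B : rand_algorithm X Y) (l q : nat) :
  (l <= q.*2)%N ->
  exists Q : quantum_algorithm R X Y q, forall phi : l.-tuple bool,
  exists2 M : 'I_1 -> 'M[R[i]]_(2 ^ q, 2 ^ shared Q), kraus_complete M &
    forall I F, quantum_expect (advised_state M) I F = rand_expect B phi I F.
Proof.
move=> lq; have [v0 [v [v0_unit v_ortho v_local]]] := exists_bell_basis R q.
pose P a := v a *m (v a)^T.
have P_sym a : (P a)^T = P a by rewrite trmx_mul trmxK.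
have P_mul a b : P a *m P b = (a == b)%:R *: P a.
  rewrite mulmxA -[_ *m _ *m v b]mulmxA v_ortho mul_mx_scalar -scalemxAl.
  by case: eqP => [->|_]; rewrite ?scale0r.
have P_tr a : \tr (P a) = 1.
  by rewrite mxtrace_mulC v_ortho eqxx mxtrace_scalar.
have P_complete : \sum_a (P a)^T *m P a = 1%:M.
  rewrite -(sum_orthonormal _ _ v v_ortho); apply: eq_bigr => a _.
  by rewrite P_sym P_mul eqxx scale1r.
exists (superdense_algorithm B l q v0 P v0_unit P_complete) => phi.
have [a lta aphi] := bitstring_surj l phi.
(* Here [l <= q.*2] enters: every message has its own Bell state. *)
have a_lt : (a < 2 ^ q * 2 ^ q)%N.
  by rewrite -expnD addnn (leq_trans lta) // leq_exp2l.
have [u u_unit uv] := v_local (Ordinal a_lt).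
exists (fun=> complexify u).
  by apply: (kraus_complete_complexify _ _ _ _ (fun=> u)); rewrite big_ord1.
move=> I F.
have -> : advised_state
    (Q := superdense_algorithm B l q v0 P v0_unit P_complete)
    (fun _ : 'I_1 => complexify u) = complexify (1 *: P (Ordinal a_lt)).
  rewrite /advised_state big_ord1 /=.
  rewrite -(map_mx1 (real_complex R)) -map_mxT -map_mxM uv adjoint_complexify.
  by rewrite -map_mxM scale1r.
rewrite /quantum_expect (quantum_expect_from_superdense _ _ _ _ _ _ _ _ _ _
  P_sym P_tr P_mul _ phi) //.
(* The simulation tosses the sum of [max_reads] over all prefixes, which is at least the maximum
   that [rand_bits] asks for. *)
rewrite mul1r -rand_expect_coin_mean //; apply/bigmax_leqP => i _.
rewrite (bigD1 i) //= (leq_trans _ (leq_addr _ _)) //.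
exact: (leq_bigmax phi).
Qed.

(** * Choice of the message length and the two reductions *)

Lemma exists_cofinal_length (b : nat -> nat) (q : nat) :
  exists2 l, (l <= q.*2)%N &
    forall n, uphalf (b n) = q -> exists2 n', (n <= n')%N & b n' = l.
Proof.
have b_cases n : uphalf (b n) = q -> b n = q.*2 \/ b n = q.*2.-1.
  move=> <-; rewrite uphalf_half; have := odd_double_half (b n).
  by case: (odd _) => /esym ?; [right | left].
have [even_cofinal|] := pselect (forall n, uphalf (b n) = q ->
    exists2 n', (n <= n')%N & b n' = q.*2); first by exists q.*2.
move=> /existsNP[n1 /not_implyP[bn1 no_even]].
exists q.*2.-1; first exact: leq_pred.
(* The maximum is [n] or [n1], so its message still has [q] qubits; being at least [n1], it cannot
   have [q.*2] bits. *)
move=> n bn; exists (maxn n n1); first exact: leq_maxl.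
have [] // := b_cases (maxn n n1); first by case: (leqP n n1).
by move=> even; case: no_even; exists (maxn n n1); first exact: leq_maxr.
Qed.

Lemma quantum_of_rand (R : realType) (X Y : Type) (P : online_problem R X Y)
    (B : rand_algorithm X Y) (c : R) (b : nat -> nat) :
  rand_competitive P B c b ->
  exists Q : (forall q : nat, quantum_algorithm R X Y q),
    quantum_competitive P Q c (fun n => uphalf (b n)).
Proof.
move=> [alpha alpha_ge0 competitive].
have simulation q : exists Q : quantum_algorithm R X Y q,
    forall (n : nat) (I : seq X), uphalf (b n) = q ->
    is_input P I -> (size I <= n)%N ->
    exists (r : nat) (M : 'I_r -> 'M[R[i]]_(2 ^ q, 2 ^ shared Q)),
      kraus_complete M /\
      competitive_on P c alpha I (quantum_expect (advised_state M) I).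
  have [l lq cofinal] := exists_cofinal_length b q.
  have [Q simQ] := superdense_simulation R X Y B l q lq.
  exists Q => n I /cofinal[n' nn' bn'] inputI sizeI.
  (* The guarantee is used at [n'] instead of [n], so that the message has the length [l] for which
     [Q] was built; [alpha] is the same. *)
  have [phi ] := competitive n' I inputI (leq_trans sizeI nn').
  move: phi; rewrite bn' => phi [feas costI].
  have [M completeM simM] := simQ phi.
  by exists 1%N, M; rewrite /competitive_on !simM.
exists (fun q => projT1 (cid (simulation q))), alpha => // n I inputI sizeI.
exact: (projT2 (cid (simulation (uphalf (b n))))).
Qed.

Definition rand_of_det {X Y : Type} (A : det_algorithm X Y) :
  rand_algorithm X Y := RandAlgorithm (fun _ _ => 0%N) (fun phi _ => A phi).

Lemma rand_of_det_competitive (R : realType) (X Y : Type)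
    (P : online_problem R X Y) (A : det_algorithm X Y) (c : R)
    (b : nat -> nat) :
  det_competitive P A c b -> rand_competitive P (rand_of_det A) c b.
Proof.
move=> [alpha alpha_ge0 competitive]; exists alpha => // n I inputI sizeI.
have [phi [feas costI]] := competitive n I inputI sizeI; exists phi.
have expectE F :
    rand_expect (rand_of_det A) phi I F = F (det_output A phi I) :> R.
  rewrite (rand_expect_coin_mean _ _ _ _ _ _ _ 0) ?coin_mean0 //.
  exact/bigmax_leqP.
by rewrite /competitive_on !expectE feas.
Qed.

Theorem theorem14 (R : realType) (X Y : Type) (P : online_problem R X Y) :
  (forall (A : det_algorithm X Y) (cA : R) (bA : nat -> nat),
     det_competitive P A cA bA ->
     exists Q : (forall q : nat, quantum_algorithm R X Y q),
       quantum_competitive P Q cA (fun n => uphalf (bA n))) /\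
  (forall (B : rand_algorithm X Y) (cB : R) (bB : nat -> nat),
     rand_competitive P B cB bB ->
     exists Q : (forall q : nat, quantum_algorithm R X Y q),
       quantum_competitive P Q cB (fun n => uphalf (bB n))).
Proof.
split=> [A cA bA /rand_of_det_competitive|B cB bB]; exact: quantum_of_rand.
Qed.
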